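(* Let $q\in(0,1)$ and $\alpha>-1$. The polynomials $(\tilde p_n^{(\alpha)}(x;q):n\ge0)$ (the monic modified $q$-Laguerre polynomials) constitute a monic orthogonal polynomial sequence corresponding to the Birth-Death process with the parameters $\tilde\lambda_n^{(\alpha)},\tilde\mu_n^{(\alpha)}$. Hence this polynomial sequence obeys the three-term recurrence relation $$\tilde p_{n+1}^{(\alpha)}(x;q)=\big(x-\tilde b_n^{(\alpha)}\big)\tilde p_n^{(\alpha)}(x;q)-\tilde d_n^{(\alpha)}\tilde p_{n-1}^{(\alpha)}(x;q),\qquad n\ge0,$$ with $\tilde p_{-1}^{(\alpha)}(x;q)=0$, where $\tilde b_n^{(\alpha)}=\tilde\lambda_n^{(\alpha)}+\tilde\mu_n^{(\alpha)}$ for $n\ge0$, and $$\tilde d_n^{(\alpha)}=\tilde\lambda_{n-1}^{(\alpha)}\tilde\mu_n^{(\alpha)}=q^{-4n-2\alpha+1}(1-q^n)(1-q^{n+\alpha})\,\frac{r_n^{(\alpha)}}{r_{n-1}^{(\alpha)}},\qquad n\ge1.$$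
   Context: Fix $q\in(0,1)$ and $\alpha>-1$. $(a;q)_n=\prod_{k=0}^{n-1}(1-aq^k)$ for $n\in\mathbb{N}_0\cup\{\infty\}$. Put $$\gamma(u,v;q)=\frac{(q^u;q)_\infty}{(q^{u+v};q)_\infty},\qquad r_n^{(\alpha)}=\frac{1-\gamma(n+1,\alpha+1;q)}{1-\gamma(n,\alpha+1;q)},\quad n\ge0$$ (note $\gamma(0,\alpha+1;q)=0$). For $\beta>-1$ the monic $q$-Laguerre polynomials are $$p_n^{(\beta)}(x;q)=(-1)^nq^{-n(n+\beta)}(q^{\beta+1};q)_n\sum_{k=0}^n\frac{(q^{-n};q)_k}{(q^{\beta+1};q)_k(q;q)_k}\,q^{k(k-1)/2}(q^{n+\beta+1}x)^k .$$ The monic modified $q$-Laguerre polynomials are $$\tilde p_n^{(\alpha)}(x;q)=r_n^{(\alpha)}p_n^{(\alpha)}(x;q)+\big(1-r_n^{(\alpha)}\big)p_n^{(\alpha+1)}(x;q),\qquad n\ge0.$$ Further, for $n\ge0$, $$\tilde\lambda_n^{(\alpha)}=\frac{q^{-2n-\alpha-1}(1-q^{n+\alpha+1})}{r_n^{(\alpha)}},\qquad\tilde\mu_n^{(\alpha)}=q^{-2n-\alpha}(1-q^n)\,r_n^{(\alpha)} .$$ A monic orthogonal polynomial sequence corresponds to the Birth-Death process with parameters $\lambda_n>0$, $\mu_{n+1}>0$ ($n\ge0$), $\mu_0\ge0$, if it is the sequence of monic orthogonal polynomials associated with the Jacobi matrix with diagonal entries $b_n=\lambda_n+\mu_n$ and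 off-diagonal entries $a_n=\sqrt{\lambda_n\mu_{n+1}}$, i.e. if it satisfies the three-term recurrence with coefficients $b_n$ and $d_n=a_{n-1}^2$. *)

(* Defs.v *)
From HB Require Import structures.
From mathcomp Require Import all_boot all_order all_algebra.
From mathcomp Require Import all_classical all_reals all_analysis.
Set Implicit Arguments.
Unset Strict Implicit.
Unset Printing Implicit Defensive.
Import Order.TTheory GRing.Theory Num.Theory.
Import numFieldNormedType.Exports.
Local Open Scope ring_scope.

Section QAnalogues.
Variable R : realType.

Definition qpoch (a q : R) (n : nat) : R := \prod_(k < n) (1 - a * q ^+ k).

Definition qpoch_inf (a q : R) : R := limn (qpoch a q).

Definition qgamma (q u v : R) : R :=
  qpoch_inf (q `^ u) q / qpoch_inf (q `^ (u + v)) q.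

Definition r_ratio (q alpha : R) (n : nat) : R :=
  (1 - qgamma q n.+1%:R (alpha + 1)) / (1 - qgamma q n%:R (alpha + 1)).

Definition qLaguerre (q beta : R) (n : nat) : {poly R} :=
  ((-1) ^+ n * q `^ (- (n%:R * (n%:R + beta))) * qpoch (q `^ (beta + 1)) q n) *:
  \sum_(k < n.+1)
    (qpoch (q ^- n) q k / (qpoch (q `^ (beta + 1)) q k * qpoch q q k)
       * q ^+ 'C(k, 2)) *:
    ((q `^ (n%:R + beta + 1)) *: 'X) ^+ k.

Definition mod_qLaguerre (q alpha : R) (n : nat) : {poly R} :=
  r_ratio q alpha n *: qLaguerre q alpha n
  + (1 - r_ratio q alpha n) *: qLaguerre q (alpha + 1) n.

Definition mod_lambda (q alpha : R) (n : nat) : R :=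
  q `^ (- (2 * n%:R) - alpha - 1) * (1 - q `^ (n%:R + alpha + 1))
  / r_ratio q alpha n.

Definition mod_mu (q alpha : R) (n : nat) : R :=
  q `^ (- (2 * n%:R) - alpha) * (1 - q ^+ n) * r_ratio q alpha n.

End QAnalogues.

Section OrthogonalPolynomials.
Variable R : realType.

(* [pred_poly p n] is p_{n-1}, with p_{-1} = 0. *)
Definition pred_poly (p : nat -> {poly R}) (n : nat) : {poly R} :=
  if n is m.+1 then p m else 0.

(* The value [d 0] is immaterial, since it multiplies p_{-1} = 0. *)
Definition three_term_recurrence (p : nat -> {poly R}) (b d : nat -> R) : Prop :=
  forall n, p n.+1 = ('X - (b n)%:P) * p n - d n *: pred_poly p n.

(* Orthogonality is with respect to a positive-definite moment functional. *)
Definition monic_OPS (p : nat -> {poly R}) : Prop :=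
  (forall n, p n \is monic /\ size (p n) = n.+1) /\
  exists L : {scalar {poly R}},
    (forall m n, m <> n -> L (p m * p n) = 0) /\
    (forall n, 0 < L (p n * p n)).

(* Jacobi matrix with diagonal b_0, b_1, ... and off-diagonal a_0, a_1, ...;
   its monic polynomials have recurrence coefficients b_n and d_n = a_{n-1}^2. *)
Definition jacobi_OPS (p : nat -> {poly R}) (b a : nat -> R) : Prop :=
  monic_OPS p /\ three_term_recurrence p b (fun n => a n.-1 ^+ 2).

Definition birth_death_parameters (lambda mu : nat -> R) : Prop :=
  (forall n, 0 < lambda n /\ 0 < mu n.+1) /\ 0 <= mu 0.

Definition birth_death_OPS (p : nat -> {poly R}) (lambda mu : nat -> R) : Prop :=
  birth_death_parameters lambda mu /\
  jacobi_OPS p (fun n => lambda n + mu n)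
               (fun n => Num.sqrt (lambda n * mu n.+1)).

End OrthogonalPolynomials.

(* Main.v *)
Require Import Defs.
From HB Require Import structures.
From mathcomp Require Import all_boot all_order all_algebra.
From mathcomp Require Import all_classical all_reals all_analysis.
From mathcomp Require Import ring lra.
Import Order.TTheory GRing.Theory Num.Theory.
Import numFieldNormedType.Exports.
Local Open Scope ring_scope.

(** Write [P] for the q-Laguerre polynomials of parameter [alpha], [K] for those
    of parameter [alpha + 1], [r] for the sequence [r_ratio] and [p] for the
    modified polynomials.  Comparing coefficients gives two first-order relations,
      [P_{n+1} - K_{n+1} = c_{n+1} K_n]  and  [x K_n = P_{n+1} + l_n P_n],
    where [lambda_n = l_n / r_n] and [mu_n = c_n r_n].  The first shows that
    [p_{n+1} = K_{n+1} + mu_{n+1} K_n].  The functional equation of [qgamma]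
    gives [lambda_n + mu_{n+1} = l_n + c_{n+1}], and this turns the second
    one into [x K_n = p_{n+1} + lambda_n p_n].  Eliminating [K] yields the
    three-term recurrence.  Positivity of the parameters comes from
    [0 <= qgamma < 1], and orthogonality from Favard's theorem. *)

(** * Finite and infinite q-Pochhammer symbols with base in [0, 1] *)

Section QPochhammer.
Variables (R : realType) (q : R).
Hypotheses (q_gt0 : 0 < q) (q_lt1 : q < 1).
Implicit Types (a x y : R) (n k : nat).

Lemma qpoch0 a : qpoch a q 0 = 1.
Proof. by rewrite /qpoch big_ord0. Qed.

Lemma qpochSl a n : qpoch a q n.+1 = (1 - a) * qpoch (a * q) q n.
Proof.
rewrite /qpoch big_ord_recl expr0 mulr1; congr (_ * _).
by apply: eq_bigr => i _; rewrite exprS mulrA.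
Qed.

Lemma qpochSr a n : qpoch a q n.+1 = qpoch a q n * (1 - a * q ^+ n).
Proof. by rewrite /qpoch big_ord_recr. Qed.

Lemma qpoch_neq0 a k : 0 <= a -> a < 1 -> qpoch a q k != 0.
Proof.
move=> a0 a1; elim: k => [|k IH]; first by rewrite qpoch0 oner_eq0.
rewrite qpochSr mulf_neq0 // subr_eq0 gt_eqF //.
by apply: le_lt_trans a1; rewrite ler_piMr // exprn_ile1 // ltW.
Qed.

Lemma qpoch_factor_ge0 a n : 0 <= a <= 1 -> 0 <= 1 - a * q ^+ n <= 1.
Proof.
move=> /andP[a0 a1]; have qn0 : 0 <= q ^+ n by rewrite exprn_ge0 // ltW.
rewrite subr_ge0 lerBlDr lerDl mulr_ge0 // andbT.
by rewrite mulr_ile1 // exprn_ile1 // ltW.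
Qed.

Lemma qpoch_ge0 a n : 0 <= a <= 1 -> 0 <= qpoch a q n.
Proof. by move=> a01; apply: prodr_ge0 => i _; case/andP: (qpoch_factor_ge0 a i a01). Qed.

Lemma is_cvg_qpoch a : 0 <= a <= 1 -> cvgn (qpoch a q).
Proof.
move=> a01; apply: nonincreasing_is_cvgn.
  apply/nonincreasing_seqP => n.
  by rewrite qpochSr ler_piMr ?qpoch_ge0 //; case/andP: (qpoch_factor_ge0 a n a01).
by exists 0 => _ [n _ <-]; exact: qpoch_ge0.
Qed.

Lemma mulq_itv a : 0 <= a <= 1 -> 0 <= a * q <= 1.
Proof. by move=> /andP[a0 a1]; rewrite mulr_ge0 ?(ltW q_gt0) // mulr_ile1 // ltW. Qed.

Lemma qpoch_infS a : 0 <= a <= 1 -> qpoch_inf a q = (1 - a) * qpoch_inf (a * q) q.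
Proof.
move=> a01; rewrite /qpoch_inf; apply/cvg_lim => //; rewrite -cvg_shiftS /=.
under eq_fun do rewrite qpochSl.
by apply: cvgMr; apply: is_cvg_qpoch; exact: mulq_itv.
Qed.

(* [prod (1 - a q^k) >= 1 - sum a q^k], a geometric sum. *)
Lemma qpoch_ge a n : 0 <= a <= 1 -> 1 - a * (1 - q ^+ n) / (1 - q) <= qpoch a q n.
Proof.
move=> a01; have [a0 a1] := andP a01.
elim: n => [|n IH]; first by rewrite qpoch0 expr0 subrr mulr0 mul0r subr0.
have le1 : qpoch a q n <= 1.
  by apply: prodr_ile1 => i _; exact: qpoch_factor_ge0.
have -> : 1 - a * (1 - q ^+ n.+1) / (1 - q)
        = 1 - a * (1 - q ^+ n) / (1 - q) - a * q ^+ n.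
  by rewrite exprS; field; rewrite subr_eq0 gt_eqF.
by rewrite qpochSr [leRHS]mulrBr mulr1 lerB // ler_piMl // mulr_ge0 // exprn_ge0 // ltW.
Qed.

(** Replaces the base by the arbitrarily small [a * q ^+ N] at the cost of a finite product; this
    reduces positivity to small bases. *)
Lemma qpoch_inf_split a N : 0 <= a <= 1 ->
  qpoch_inf a q = qpoch a q N * qpoch_inf (a * q ^+ N) q.
Proof.
elim: N a => [|N IH] a a01; first by rewrite qpoch0 expr0 mul1r mulr1.
by rewrite qpoch_infS // IH ?mulq_itv // qpochSl exprS !mulrA.
Qed.

(** In the limit the geometric bound [qpoch_ge] becomes [1 - a / (1 - q)], which is positive exactly
    for such [a]. *)
Lemma qpoch_inf_gt0_small a : 0 <= a -> a < 1 - q -> 0 < qpoch_inf a q.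
Proof.
move: q_gt0 => q0 a0 aq; have a01 : 0 <= a <= 1 by apply/andP; split; lra.
apply: (@lt_le_trans _ _ (1 - a / (1 - q))).
  by rewrite subr_gt0 ltr_pdivrMr ?subr_gt0 // mul1r.
apply: limr_ge; first exact: is_cvg_qpoch.
apply: nearW => n; apply: le_trans (qpoch_ge a n a01).
rewrite lerB // ler_pM2r ?invr_gt0 ?subr_gt0 // ler_piMr //.
by rewrite lerBlDr lerDl exprn_ge0 // ltW.
Qed.

Lemma qpoch_inf_gt0 a : 0 <= a -> a < 1 -> 0 < qpoch_inf a q.
Proof.
move=> a0 a1; have a01 : 0 <= a <= 1 by apply/andP; split; lra.
have : (\forall n \near \oo, q ^+ n < 1 - q)%classic.
  have c : (q ^+ n @[n --> \oo] --> (0 : R))%classic.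
    by apply: cvg_expr; rewrite gtr0_norm.
  by apply: (cvgr_lt 0 c); rewrite subr_gt0.
move=> [N _ /(_ N (leqnn N)) /= qN].
have qN0 : 0 <= q ^+ N by rewrite exprn_ge0 // ltW.
rewrite (qpoch_inf_split a N) // mulr_gt0 //.
  by rewrite lt_def qpoch_neq0 // qpoch_ge0.
apply: qpoch_inf_gt0_small; first exact: mulr_ge0.
by apply: le_lt_trans qN; rewrite ler_piMl // ltW.
Qed.

(** Factorwise comparison survives the limit only as a weak inequality. The first factors are
    therefore split off: they differ strictly, and the remaining product at [y * q < 1] is positive.
    The endpoint [x = 1] is allowed because [q ^+ 0] occurs as a base in [qgamma]. *)
Lemma qpoch_inf_lt x y : 0 <= y -> y < x -> x <= 1 -> qpoch_inf x q < qpoch_inf y q.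
Proof.
move=> y0 yx x1; have x01 : 0 <= x <= 1 by apply/andP; split; lra.
have y01 : 0 <= y <= 1 by apply/andP; split; lra.
have yq1 : y * q < 1 by rewrite mulr_ilt1 ?(ltW q_gt0) // (lt_le_trans yx).
rewrite (qpoch_infS x) // (qpoch_infS y) //.
apply: (@le_lt_trans _ _ ((1 - x) * qpoch_inf (y * q) q)).
  rewrite ler_wpM2l ?subr_ge0 //; apply: ler_lim.
  - by apply: is_cvg_qpoch; exact: mulq_itv.
  - by apply: is_cvg_qpoch; exact: mulq_itv.
  apply: nearW => n; apply: ler_prod => i _.
  have /andP[-> _] /= := qpoch_factor_ge0 (x * q) i (mulq_itv x x01).
  by rewrite lerB // !ler_pM2r ?exprn_gt0 // ltW.
rewrite ltr_pM2r ?ltrD2l ?ltrN2 //.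
by apply: qpoch_inf_gt0 => //; case/andP: (mulq_itv y y01).
Qed.

End QPochhammer.

(** * Coefficients of the q-Laguerre polynomials and their contiguous relations *)

Section QLaguerreCoefficients.
Variables (R : realType) (q : R).
Hypotheses (q_gt0 : 0 < q) (q_lt1 : q < 1).
Implicit Types (a B : R) (n k : nat).

(* Coefficient of [x^k] in [qLaguerre q beta n], with [B] standing for [q^beta];
   the factor [(q^{-n};q)_k] makes it vanish for [k > n]. *)
Definition qLaguerre_coef B n k : R :=
  (-1) ^+ n * (q ^+ n * B) ^- n * qpoch (B * q) q n *
  (qpoch (q ^- n) q k / (qpoch (B * q) q k * qpoch q q k) * q ^+ 'C(k, 2)
   * (q ^+ n * B * q) ^+ k).

Let q_neq0 : q != 0. Proof. exact: lt0r_neq0. Qed.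
Let qXn_neq0 n : q ^+ n != 0. Proof. by rewrite expf_neq0. Qed.

Lemma qpoch_invX_eq0 n k : (n < k)%N -> qpoch (q ^- n) q k = 0.
Proof.
move=> lt_nk; rewrite /qpoch (bigD1 (Ordinal lt_nk)) //= mulVf // subrr.
exact: mul0r.
Qed.

(** Real powers of [q] become natural powers of [q] and of [q^beta], so that later identities are
    rational. No bound on [k] is imposed, which spares a separate treatment of the leading
    coefficients. *)
Lemma coef_qLaguerre beta n k :
  (qLaguerre q beta n)`_k = qLaguerre_coef (q `^ beta) n k.
Proof.
have qpow r s : q `^ (r + s) = q `^ r * q `^ s.
  by rewrite powRD // q_neq0 implybT.
have qnat m : q `^ m%:R = q ^+ m by rewrite powR_mulrn // ltW.
have qB1 : q `^ (beta + 1) = q `^ beta * q by rewrite qpow powRr1 // ltW.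
have qnB : q `^ (n%:R + beta + 1) = q ^+ n * q `^ beta * q.
  by rewrite !qpow qnat powRr1 // ltW.
have qpre : q `^ (- (n%:R * (n%:R + beta))) = (q ^+ n * q `^ beta) ^- n.
  rewrite powRN mulrC powRrM qpow qnat powR_mulrn //.
  by rewrite mulr_ge0 ?powR_ge0 ?exprn_ge0 // ltW.
rewrite /qLaguerre /qLaguerre_coef qB1 qnB qpre coefZ; congr (_ * _).
pose E k := qpoch (q ^- n) q k / (qpoch (q `^ beta * q) q k * qpoch q q k)
  * q ^+ 'C(k, 2) * (q ^+ n * q `^ beta * q) ^+ k.
rewrite (eq_bigr (fun i : 'I_n.+1 => E i *: 'X^i)) => [|i _]; last first.
  by rewrite exprZn scalerA.
rewrite -(poly_def n.+1 E) coef_poly ltnS; case: leqP => // lt_nk.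
by rewrite qpoch_invX_eq0 // !mul0r.
Qed.

Lemma qpoch_shift a n : qpoch a q n * (1 - a * q ^+ n) = (1 - a) * qpoch (a * q) q n.
Proof. by rewrite -qpochSr qpochSl. Qed.

(** Since [q^(-n-1) * q = q^(-n)], raising both indices only adds a front factor; the relations
    below compare such neighbours. *)
Lemma qpoch_invXS n k :
  qpoch (q ^- n.+1) q k.+1 = (1 - (q * q ^+ n)^-1) * qpoch (q ^- n) q k.
Proof. by rewrite qpochSl exprS invfM mulrAC mulVf // mul1r. Qed.

Section Relations.
Variables (B : R) (B_gt0 : 0 < B) (Bq_lt1 : B * q < 1).

Let B_neq0 : B != 0. Proof. exact: lt0r_neq0. Qed.

Let qfac_neq0 a n : 0 <= a -> a < 1 -> 1 - a * q ^+ n != 0.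
Proof.
move=> a0 a1; rewrite subr_eq0 gt_eqF //.
by apply: le_lt_trans a1; rewrite ler_piMr // exprn_ile1 // ltW.
Qed.

Let Bq_ge0 : 0 <= B * q. Proof. by rewrite mulr_ge0 // ltW. Qed.
Let Bqq_ge0 : 0 <= B * q * q. Proof. by rewrite mulr_ge0 // ltW. Qed.
Let Bqq_lt1 : B * q * q < 1.
Proof. by rewrite mulr_ilt1 // ltW. Qed.

Let binS2 k : q ^+ 'C(k.+1, 2) = q ^+ 'C(k, 2) * q ^+ k.
Proof. by rewrite binS bin1 exprD. Qed.

(** Lets the parameters alpha and alpha + 1 share one symbol, with base [B * q * q], which then
    cancels. *)
Let qpoch_Bq n : qpoch (B * q) q n =
  (1 - B * q) * qpoch (B * q * q) q n / (1 - B * q * q ^+ n).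
Proof. by rewrite -qpoch_shift mulfK // qfac_neq0. Qed.

Let neqs n k : [/\ 1 - B * q != 0, 1 - B * q * q ^+ n != 0,
  1 - B * q * q * q ^+ k != 0, 1 - q * q ^+ k != 0
  & qpoch (B * q * q) q k != 0 /\ qpoch q q k != 0].
Proof.
split; rewrite ?qfac_neq0 ?qpoch_neq0 //; try exact: ltW.
  by rewrite subr_eq0 gt_eqF.
Qed.

Lemma qLaguerre_coef_connection n k :
  qLaguerre_coef B n.+1 k - qLaguerre_coef (B * q) n.+1 k
  = (1 - q ^+ n.+1) / (q * q ^+ n) ^+ 2 / B * qLaguerre_coef (B * q) n k.
Proof.
rewrite /qLaguerre_coef; case: k => [|j].
  rewrite !qpoch0 !bin0n !expr0 !(qpochSl _ _ (B * q)) (qpochSr _ _ (B * q * q)).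
  rewrite !(exprS q n) !(exprS (-1)) !(exprSr (q * _ * _) n) !exprMn.
  have := expf_neq0 n (qXn_neq0 n); have := expf_neq0 n B_neq0.
  (* Powers with exponent depending on [n] become independent atoms, leaving a rational identity for
     [field]. *)
  move: (q ^+ n ^+ n) (B ^+ n) (q ^+ n) (qXn_neq0 n) => w w' u u0 w'0 w0.
  by field; rewrite u0 w'0 w0 B_neq0 q_neq0.
have [n1 n2 n3 n4 [n5 n6]] := neqs n j.
rewrite !qpoch_invXS (qpochSr _ _ (q ^- n)) !binS2 (qpochSr _ _ q).
rewrite !(qpochSl _ _ (B * q)) !(qpochSr _ _ (B * q * q)).
rewrite !(exprS q n) !(exprS (-1)) !(exprSr (q * _ * _) n) !(exprSr (_ * q) j) !exprMn.
have := expf_neq0 n (qXn_neq0 n); have := expf_neq0 n B_neq0.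
move: (q ^+ n ^+ n) (B ^+ n) (q ^+ n ^+ j) (B ^+ j) => w w' t t' w'0 w0.
by field; rewrite ?n1 ?n3 ?n4 ?n5 ?n6 ?w'0 ?w0 ?B_neq0 ?q_neq0 ?qXn_neq0.
Qed.

(** Coefficient form of [x K_n = P_{n+1} + l_n P_n]: multiplication by x shifts the index, and after
    reduction to common symbols a rational identity remains. *)
Lemma qLaguerre_coef_mulX n k : qLaguerre_coef (B * q) n k
  = qLaguerre_coef B n.+1 k.+1
    + (1 - B * q * q ^+ n) / (q * (q ^+ n) ^+ 2 * B) * qLaguerre_coef B n k.+1.
Proof.
have [n1 n2 n3 n4 [n5 n6]] := neqs n k.
rewrite /qLaguerre_coef.
rewrite !qpoch_invXS (qpochSr _ _ (q ^- n)) !binS2 (qpochSr _ _ q).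
rewrite (qpochSl _ _ (B * q) n) (qpochSl _ _ (B * q) k) (qpoch_Bq n).
rewrite !(exprS q n) !(exprS (-1)) !(exprSr (q * _ * _) n) !(exprSr (_ * q) k) !exprMn.
have := expf_neq0 n (qXn_neq0 n); have := expf_neq0 n B_neq0.
move: (q ^+ n ^+ n) (B ^+ n) (q ^+ n ^+ k) (B ^+ k) => w w' t t' w'0 w0.
by field; rewrite ?n1 ?n2 ?n3 ?n4 ?n5 ?n6 ?w'0 ?w0 ?B_neq0 ?q_neq0 ?qXn_neq0.
Qed.

Lemma qLaguerre_coef_mulX0 n : 0 = qLaguerre_coef B n.+1 0
  + (1 - B * q * q ^+ n) / (q * (q ^+ n) ^+ 2 * B) * qLaguerre_coef B n 0.
Proof.
have [n1 n2 _ _ _] := neqs n 0.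
rewrite /qLaguerre_coef !qpoch0 !bin0n !expr0 (qpochSl _ _ (B * q)) (qpoch_Bq n).
rewrite !(exprS q n) !(exprS (-1)) !(exprSr (q * _ * _) n) !exprMn.
have := expf_neq0 n (qXn_neq0 n); have := expf_neq0 n B_neq0.
move: (q ^+ n ^+ n) (B ^+ n) => w w' w'0 w0.
by field; rewrite ?n1 ?n2 ?w'0 ?w0 ?B_neq0 ?q_neq0 ?qXn_neq0.
Qed.

End Relations.
End QLaguerreCoefficients.

(** * Favard's theorem, with the moment functional built recursively *)

Section Favard.
Variables (R : realType) (p : nat -> {poly R}) (b d : nat -> R).
Hypotheses (p0 : p 0 = 1) (ttr : three_term_recurrence p b d).

Lemma ttr_monic_size n : p n \is monic /\ size (p n) = n.+1.
Proof.
(* The size of the preceding polynomial joins the induction, so that the subtracted term cannot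
   reach the leading one. *)
suff: [/\ p n \is monic, size (p n) = n.+1 & (size (pred_poly p n) <= n)%N].
  by case.
elim: n => [|n [mn sn pn]].
  by rewrite p0 monic1 size_poly1 /= size_poly0.
have mX := monicXsubC (b n).
have s1 : size (('X - (b n)%:P) * p n)%R = n.+2.
  by rewrite size_Mmonic ?monic_neq0 // size_XsubC sn.
have lt2 : (size (- (d n *: pred_poly p n))%R < size (('X - (b n)%:P) * p n)%R)%N.
  by rewrite size_polyN s1 ltnS (leq_trans (size_scale_leq _ _)) // leqW.
split; last by rewrite /= sn.
  by rewrite ttr monicE lead_coefDl // -monicE monicMl.
by rewrite ttr size_polyDl.
Qed.

(* The [m]-th moment is the unique value making [moment_functional (p m)] equal
   to [1] if [m = 0] and to [0] otherwise. *)
Fixpoint moment_seq n : seq R :=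
  if n is m.+1 then
    rcons (moment_seq m)
      ((m == 0%N)%:R - \sum_(i < m) (p m)`_i * (moment_seq m)`_i)
  else [::].

Definition moment n : R := (moment_seq n.+1)`_n.

Lemma size_moment_seq n : size (moment_seq n) = n.
Proof. by elim: n => //= n IH; rewrite size_rcons IH. Qed.

Lemma nth_moment_seq n i : (i < n)%N -> (moment_seq n)`_i = moment i.
Proof.
elim: n => // n IH; rewrite ltnS leq_eqVlt => /predU1P[-> //|lt_in].
by rewrite /= nth_rcons size_moment_seq lt_in IH.
Qed.

Definition moment_functional (f : {poly R}) : R :=
  \sum_(i < size f) f`_i * moment i.

Lemma moment_functionalE n (f : {poly R}) : (size f <= n)%N ->
  moment_functional f = \sum_(i < n) f`_i * moment i.
Proof.
move=> le_fn; rewrite /moment_functional (big_ord_widen n (fun i => f`_i * moment i)) //.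
rewrite [RHS](bigID (fun i : 'I_n => (i < size f)%N)) /= [X in _ = _ + X]big1 ?addr0 //.
by move=> i; rewrite -leqNgt => le_fi; rewrite nth_default // mul0r.
Qed.

Lemma moment_functional_is_linear : scalar moment_functional.
Proof.
move=> c f g; set n := maxn (size f) (size g).
have sf : (size f <= n)%N := leq_maxl _ _.
have sg : (size g <= n)%N := leq_maxr _ _.
have scf : (size (c *: f)%R <= n)%N by apply: leq_trans sf; exact: size_scale_leq.
have s : (size (c *: f + g)%R <= n)%N.
  by apply: leq_trans (size_polyD _ _) _; rewrite geq_max scf.
rewrite (moment_functionalE n) // (moment_functionalE n f) // (moment_functionalE n g) //.
rewrite mulr_sumr -big_split; apply: eq_bigr => i _ /=.
by rewrite coefD coefZ mulrDl mulrA.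
Qed.

HB.instance Definition _ :=
  GRing.isLinear.Build R {poly R} R *%R moment_functional moment_functional_is_linear.

(** Monicity isolates [moment n] in the sum, and its definition cancels the lower terms. *)
Lemma moment_functional_p n : moment_functional (p n) = (n == 0%N)%:R.
Proof.
have [mn sn] := ttr_monic_size n.
rewrite (moment_functionalE n.+1) ?sn // big_ord_recr /=.
have -> : (p n)`_n = 1 by move: mn; rewrite monicE /lead_coef sn => /eqP.
rewrite mul1r /moment /= nth_rcons size_moment_seq ltnn eqxx addrC -addrA.
rewrite [X in _ + X](_ : _ = 0) ?addr0 //; apply/eqP; rewrite addrC subr_eq0.
by apply/eqP/eq_bigr => i _; rewrite nth_moment_seq.
Qed.

Let L : {scalar {poly R}} := moment_functional.

Let L_p n : L (p n) = (n == 0%N)%:R.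
Proof. exact: moment_functional_p. Qed.

Lemma mulX_ttr n : 'X * p n = p n.+1 + b n *: p n + d n *: pred_poly p n.
Proof. by rewrite ttr mulrBl mul_polyC; ring. Qed.

Lemma moment_Xn_pS m n : L ('X^(m.+1) * p n)
  = L ('X^m * p n.+1) + b n * L ('X^m * p n) + d n * L ('X^m * pred_poly p n).
Proof.
by rewrite exprSr -mulrA mulX_ttr !mulrDr -!scalerAr !linearD /= !linearZ.
Qed.

(** By the recurrence each factor ['X] lowers the index of [p] by at most one, so [p 0] is never
    reached. *)
Lemma moment_Xn_p_eq0 m n : (m < n)%N -> L ('X^m * p n) = 0.
Proof.
elim: m n => [|m IH] n lt_mn; first by rewrite expr0 mul1r L_p gtn_eqF.
case: n lt_mn => // n lt_mn; rewrite moment_Xn_pS /=.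
have lt_mn1 : (m < n.+1)%N := ltnW lt_mn.
by rewrite !IH ?mulr0 ?addr0 // ltnW.
Qed.

Lemma moment_XnS_pS n : L ('X^(n.+1) * p n.+1) = d n.+1 * L ('X^n * p n).
Proof.
rewrite moment_Xn_pS (moment_Xn_p_eq0 n n.+2) 1?(moment_Xn_p_eq0 n n.+1) //.
by rewrite mulr0 !add0r.
Qed.

Lemma moment_mul_p_coef (f : {poly R}) n : (size f <= n.+1)%N ->
  L (f * p n) = f`_n * L ('X^n * p n).
Proof.
move=> sf; have -> : f = \sum_(i < n.+1) f`_i *: 'X^i.
  rewrite -poly_def; apply/polyP => i; rewrite coef_poly.
  by case: ltnP => // le; rewrite nth_default // (leq_trans sf).
rewrite mulr_suml linear_sum big_ord_recr /= big1 ?add0r.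
  rewrite -scalerAl linearZ /=; congr (_ * _).
  by rewrite -poly_def coef_poly ltnSn.
by move=> i _; rewrite -scalerAl linearZ /= moment_Xn_p_eq0 // mulr0.
Qed.

(** Expanding the factor of lower degree in powers of ['X] gives orthogonality. By monicity
    [L (p n * p n) = L ('X^n * p n)], which is the product of [d 1], ..., [d n]. *)
Lemma favard : (forall n, 0 < d n.+1) -> monic_OPS p.
Proof.
move=> d_gt0; split; first exact: ttr_monic_size.
have lt_orth m n : (m < n)%N -> L (p m * p n) = 0.
  move=> lt_mn; have [_ sm] := ttr_monic_size m.
  by rewrite moment_mul_p_coef ?sm ?(leq_trans lt_mn) // nth_default ?sm // mul0r.
exists L; split=> [m n /eqP|n].
  by rewrite neq_ltn => /orP[/lt_orth //|]; rewrite mulrC => /lt_orth.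
have [mn sn] := ttr_monic_size n.
rewrite moment_mul_p_coef ?sn //; move: mn; rewrite monicE /lead_coef sn => /eqP ->.
rewrite mul1r; elim: n {sn} => [|n IH]; last by rewrite moment_XnS_pS mulr_gt0.
by rewrite expr0 mul1r L_p.
Qed.

End Favard.

(** * Three-term recurrence from the two first-order relations, for abstract sequences *)

Section QuasiOrthogonal.
Variables (R : realType) (P K p : nat -> {poly R}) (r c l : nat -> R).
Hypotheses (P0 : P 0 = 1) (K0 : K 0 = 1) (c0 : c 0 = 0).
Hypothesis connection : forall n, P n.+1 - K n.+1 = c n.+1 *: K n.
Hypothesis mulX : forall n, 'X * K n = P n.+1 + l n *: P n.
Hypothesis r_neq0 : forall n, r n != 0.
Hypothesis balance : forall n, c n.+1 * r n.+1 + l n / r n = c n.+1 + l n.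
Hypothesis pE : forall n, p n = r n *: P n + (1 - r n) *: K n.

Let lam n := l n / r n.
Let mu n := c n * r n.

Let p0 : p 0 = 1.
Proof. by rewrite pE P0 K0 -scalerDl addrC subrK scale1r. Qed.

Let PS n : P n.+1 = K n.+1 + (c n.+1)%:P * K n.
Proof. by rewrite mul_polyC -connection addrC subrK. Qed.

Let pS n : p n.+1 = K n.+1 + (mu n.+1)%:P * K n.
Proof. by rewrite pE PS -!mul_polyC /mu rmorphB rmorphM /=; ring. Qed.

(* [K] is the sequence of kernel polynomials of [p]. *)
Let mulX_p n : 'X * K n = p n.+1 + (lam n)%:P * p n.
Proof.
(* Expressing [l n] and [c n.+1] polynomially in [lam], [mu] and [r] removes all divisions, so
   [ring] can conclude. *)
have lE : l n = lam n * r n by rewrite /lam divfK.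
have cE : c n.+1 = mu n.+1 + lam n - l n by rewrite /mu /lam balance addrK.
rewrite mulX PS pS -mul_polyC; case: n lE cE => [|n] lE cE.
  by rewrite P0 p0 K0 cE rmorphB rmorphD /=; ring.
rewrite PS pS [X in X%:P * K n.+1]cE /mu [l _]lE !rmorphB !rmorphD !rmorphM /=.
ring.
Qed.

Lemma quasi_orthogonal_ttr :
  three_term_recurrence p (fun n => lam n + mu n) (fun n => lam n.-1 * mu n).
Proof.
(* At index 0 the value [lam 0.-1 = lam 0] is harmless, as it multiplies the zero polynomial;
   [c 0 = 0] makes [mu 0] vanish. *)
case=> [|n] /=.
  have := mulX_p 0; rewrite p0 K0 !mulr1 => ->.
  by rewrite /mu c0 mul0r addr0 scaler0 subr0 addrK.
have -> : p n.+2 = 'X * K n.+1 - (lam n.+1)%:P * p n.+1.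
  by rewrite mulX_p addrK.
have -> : ('X - (lam n.+1 + mu n.+1)%:P) * p n.+1
  = 'X * p n.+1 - (lam n.+1)%:P * p n.+1 - (mu n.+1)%:P * p n.+1.
  by rewrite rmorphD /=; ring.
have -> : 'X * p n.+1 = 'X * K n.+1 + (mu n.+1)%:P * ('X * K n).
  by rewrite pS; ring.
by rewrite (mulX_p n) -mul_polyC rmorphM /=; ring.
Qed.

End QuasiOrthogonal.

(** * The modified q-Laguerre polynomials: the sequence [r_ratio], the recurrence and its
    parameters *)

Section ModifiedQLaguerre.
Variables (R : realType) (q alpha : R).
Hypotheses (q_gt0 : 0 < q) (q_lt1 : q < 1) (alpha_gtN1 : -1 < alpha).
Implicit Types (n k : nat).

Let B := q `^ alpha.
Let G n := qgamma q n%:R (alpha + 1).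
Let r := r_ratio q alpha.

Let q_neq0 : q != 0. Proof. exact: lt0r_neq0. Qed.
Let qXn_neq0 n : q ^+ n != 0. Proof. by rewrite expf_neq0. Qed.
Let B_gt0 : 0 < B. Proof. exact: powR_gt0. Qed.
Let B_neq0 : B != 0. Proof. exact: lt0r_neq0. Qed.
Let powRDq s t : q `^ (s + t) = q `^ s * q `^ t.
Proof. by rewrite powRD // q_neq0 implybT. Qed.
Let powRq1 : q `^ 1 = q. Proof. by rewrite powRr1 // ltW. Qed.
Let powRqn n : q `^ n%:R = q ^+ n. Proof. by rewrite powR_mulrn // ltW. Qed.
Let powRBq : q `^ (alpha + 1) = B * q. Proof. by rewrite powRDq powRq1. Qed.

Let Bq_gt0 : 0 < B * q. Proof. exact: mulr_gt0. Qed.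

(** Here [alpha + 1 > 0] and [ln q < 0] give a negative exponent. *)
Let Bq_lt1 : B * q < 1.
Proof.
rewrite -powRBq /powR (negPf q_neq0) -[ltRHS]expR0 ltr_expR.
by rewrite pmulr_rlt0 ?ln_lt0 ?q_gt0 // -ltrBlDr sub0r.
Qed.

Let qn_itv n : 0 <= q ^+ n <= 1.
Proof. by rewrite exprn_ge0 ?exprn_ile1 // ltW. Qed.

Let Bqn_ge0 n : 0 <= B * q * q ^+ n.
Proof. by rewrite mulr_ge0 ?(ltW Bq_gt0) //; case/andP: (qn_itv n). Qed.

Let Bqn_lt1 n : B * q * q ^+ n < 1.
Proof.
apply: le_lt_trans Bq_lt1; rewrite ler_piMr ?(ltW Bq_gt0) //.
by case/andP: (qn_itv n).
Qed.

Let GE n : G n = qpoch_inf (q ^+ n) q / qpoch_inf (B * q * q ^+ n) q.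
Proof. by rewrite /G /qgamma powRDq powRqn powRBq [q ^+ n * _]mulrC. Qed.

Let denG_gt0 n : 0 < qpoch_inf (B * q * q ^+ n) q.
Proof. exact: qpoch_inf_gt0. Qed.

(** The base [B * q * q ^+ n] of the denominator is below [q ^+ n], and the infinite symbol
    decreases strictly in its base. *)
Lemma qgamma_lt1 n : 0 < 1 - G n.
Proof.
rewrite subr_gt0 GE ltr_pdivrMr // mul1r qpoch_inf_lt //.
  by rewrite gtr_pMl // exprn_gt0.
by case/andP: (qn_itv n).
Qed.

(** Numerator and denominator each lose their first factor. The product form stays valid at [n = 0],
    where [1 - q ^+ n] vanishes. *)
Lemma qgammaS n : (1 - q ^+ n) * G n.+1 = (1 - B * q * q ^+ n) * G n.
Proof.
have h : 0 <= B * q * q ^+ n <= 1 by rewrite Bqn_ge0 ltW.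
rewrite !GE (qpoch_infS _ _ q_gt0 q_lt1 (q ^+ n)) //.
rewrite (qpoch_infS _ _ q_gt0 q_lt1 (B * q * q ^+ n)) //.
rewrite -[B * q * q ^+ n * q]mulrA -!exprSr.
have := lt0r_neq0 (denG_gt0 n.+1).
have : 1 - B * q * q ^+ n != 0 by rewrite subr_eq0 gt_eqF.
move: (qpoch_inf _ _) (qpoch_inf _ _) => x y n1 n2.
by field; rewrite n1 n2.
Qed.

Lemma r_ratio_gt0 n : 0 < r n.
Proof. by rewrite /r /r_ratio divr_gt0 ?qgamma_lt1. Qed.

Lemma r_ratio_balance n :
  (1 - q ^+ n.+1) * (r n.+1 - 1) = q * (1 - B * q * q ^+ n) * (1 - (r n)^-1).
Proof.
have g0 := lt0r_neq0 (qgamma_lt1 n); have g1 := lt0r_neq0 (qgamma_lt1 n.+1).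
have e0 := qgammaS n; have e1 := qgammaS n.+1.
rewrite /r /r_ratio -!/(G _); move: e0 e1 g0 g1; rewrite exprS.
move: (G n) (G n.+1) (G n.+2) (q ^+ n) => x y z u e0 e1 g0 g1.
(* The functional equation at [n] and [n.+1] links consecutive differences of [G]; dividing by
   [1 - G n.+1] yields the claim. *)
have e : (1 - q * u) * (y - z) = q * (1 - B * q * u) * (x - y).
  by rewrite mulrBr e1 -[RHS]mulrA mulrBr -e0; ring.
have -> : (1 - z) / (1 - y) - 1 = (y - z) / (1 - y) by field.
have -> : 1 - ((1 - y) / (1 - x))^-1 = (x - y) / (1 - y).
  by field; rewrite g0 g1.
by rewrite [LHS]mulrA e mulrA.
Qed.

(** With [B = q^alpha], [l n] is [q^(-2n-alpha-1) (1 - q^(n+alpha+1))] and [c n] is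
    [q^(-2n-alpha) (1 - q^n)], written rationally. *)
Let l n := (1 - B * q * q ^+ n) / (q * (q ^+ n) ^+ 2 * B).
Let c n := (1 - q ^+ n) / (q ^+ n) ^+ 2 / B.

Lemma mod_lambdaE n : mod_lambda q alpha n = l n / r n.
Proof.
rewrite /mod_lambda /l -/r; congr (_ / _).
rewrite !powRDq !powRN powRq1 powRqn mulrC.
rewrite [2 * _]mulrC powRrM powRqn (powR_mulrn 2) ?exprn_ge0 ?(ltW q_gt0) // -/B.
rewrite (_ : q ^+ n * B * q = B * q * q ^+ n); last by ring.
congr (_ * _); field.
by rewrite ?B_neq0 ?q_neq0 ?qXn_neq0.
Qed.

Lemma mod_muE n : mod_mu q alpha n = c n * r n.
Proof.
rewrite /mod_mu /c -/r; congr (_ * _).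
rewrite !powRDq !powRN mulrC.
rewrite [2 * _]mulrC powRrM powRqn (powR_mulrn 2) ?exprn_ge0 ?(ltW q_gt0) // -/B.
by rewrite -mulrA.
Qed.

Lemma qLaguerre0 beta : qLaguerre q beta 0 = 1.
Proof.
apply/polyP => -[|k]; rewrite coef_qLaguerre // coef1 /qLaguerre_coef.
  by rewrite !qpoch0 !expr0 /= ?invr1 !mulr1 ?invr1 ?mulr1.
by rewrite qpoch_invX_eq0 // !mul0r mulr0.
Qed.

Lemma qLaguerre_connection n :
  qLaguerre q alpha n.+1 - qLaguerre q (alpha + 1) n.+1
  = c n.+1 *: qLaguerre q (alpha + 1) n.
Proof.
apply/polyP => k; rewrite coefB (coefZ (c n.+1)) !coef_qLaguerre // powRBq.
by rewrite -/B qLaguerre_coef_connection // /c exprS.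
Qed.

Lemma qLaguerre_mulX n : 'X * qLaguerre q (alpha + 1) n
  = qLaguerre q alpha n.+1 + l n *: qLaguerre q alpha n.
Proof.
apply/polyP => -[|k]; rewrite coefXM coefD (coefZ (l n)) !coef_qLaguerre //= -/B.
  exact: qLaguerre_coef_mulX0.
by rewrite powRBq qLaguerre_coef_mulX.
Qed.

Lemma mod_qLaguerre_ttr : three_term_recurrence (mod_qLaguerre q alpha)
  (fun n => mod_lambda q alpha n + mod_mu q alpha n)
  (fun n => mod_lambda q alpha n.-1 * mod_mu q alpha n).
Proof.
have rn0 n : r n != 0 by rewrite lt0r_neq0 // r_ratio_gt0.
(* This is [r_ratio_balance] divided by [(q ^+ n.+1) ^+ 2 * B]. *)
have bal n : c n.+1 * r n.+1 + l n / r n = c n.+1 + l n.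
  have /eqP := r_ratio_balance n; rewrite -subr_eq0 => /eqP e.
  apply/eqP; rewrite -subr_eq0; apply/eqP.
  have -> : c n.+1 * r n.+1 + l n / r n - (c n.+1 + l n)
    = ((1 - q ^+ n.+1) * (r n.+1 - 1) - q * (1 - B * q * q ^+ n) * (1 - (r n)^-1))
      / ((q ^+ n.+1) ^+ 2 * B).
    rewrite /c /l exprS; field.
    by rewrite ?B_neq0 ?q_neq0 ?qXn_neq0 ?rn0.
  by rewrite e mul0r.
have c0 : c 0 = 0 by rewrite /c expr0 subrr !mul0r.
move=> n; rewrite !mod_lambdaE !mod_muE.
exact: (quasi_orthogonal_ttr _ _ _ _ _ _ _ (qLaguerre0 _) (qLaguerre0 _) c0
  qLaguerre_connection qLaguerre_mulX rn0 bal (fun=> erefl)).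
Qed.

Lemma mod_qLaguerre0 : mod_qLaguerre q alpha 0 = 1.
Proof. by rewrite /mod_qLaguerre !qLaguerre0 -scalerDl addrC subrK scale1r. Qed.

Lemma mod_birth_death_parameters :
  birth_death_parameters (mod_lambda q alpha) (mod_mu q alpha).
Proof.
have q2_gt0 n : 0 < (q ^+ n) ^+ 2 by rewrite !exprn_gt0.
split=> [n|]; last by rewrite /mod_mu expr0 subrr mulr0 mul0r.
rewrite mod_lambdaE mod_muE; split.
  apply: divr_gt0 (r_ratio_gt0 n); apply: divr_gt0; first by rewrite subr_gt0.
  by rewrite mulr_gt0 // mulr_gt0.
apply: mulr_gt0 (r_ratio_gt0 n.+1); apply: divr_gt0 => //; apply: divr_gt0 => //.
by rewrite subr_gt0 exprn_ilt1 // ltW.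
Qed.

Lemma mod_dE n : mod_lambda q alpha n * mod_mu q alpha n.+1
  = q `^ (- (4 * n.+1%:R) - 2 * alpha + 1) * (1 - q ^+ n.+1)
    * (1 - q `^ (n.+1%:R + alpha)) * (r n.+1 / r n).
Proof.
rewrite mod_lambdaE mod_muE /l /c !powRDq !powRN powRq1.
rewrite [4 * _]mulrC [2 * _]mulrC !powRrM !powRqn -/B.
rewrite !powR_mulrn ?exprn_ge0 ?(ltW q_gt0) ?(ltW B_gt0) //.
rewrite (exprS q n); field.
by rewrite ?B_neq0 ?q_neq0 ?qXn_neq0 ?lt0r_neq0 ?r_ratio_gt0.
Qed.

End ModifiedQLaguerre.

Theorem theorem5p5 (R : realType) (q alpha : R)
    (q_gt0 : 0 < q) (q_lt1 : q < 1) (alpha_gtN1 : -1 < alpha) :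
  let p := mod_qLaguerre q alpha in
  let lambda := mod_lambda q alpha in
  let mu := mod_mu q alpha in
  let b := fun n : nat => lambda n + mu n in
  let d := fun n : nat => lambda n.-1 * mu n in
  [/\ birth_death_OPS p lambda mu,
      three_term_recurrence p b d
    & forall n : nat, (1 <= n)%N ->
        d n = q `^ (- (4 * n%:R) - 2 * alpha + 1) * (1 - q ^+ n)
              * (1 - q `^ (n%:R + alpha))
              * (r_ratio q alpha n / r_ratio q alpha n.-1)].
Proof.
move=> p lambda mu b d.
have bd : birth_death_parameters lambda mu by exact: mod_birth_death_parameters.
have ttr : three_term_recurrence p b d by exact: mod_qLaguerre_ttr.
have d_gt0 n : 0 < d n.+1 by rewrite mulr_gt0 //; case: (bd.1 n).
split=> // [|[//|n] _]; last exact: mod_dE.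
do 2![split=> //].
  by apply: favard ttr d_gt0; exact: mod_qLaguerre0.
(* The squared Jacobi entry differs from [d] only at index 0, where it multiplies zero; elsewhere
   positivity lets the square undo the root. *)
case=> [|n]; rewrite ttr /= ?scaler0 //.
by rewrite sqr_sqrtr // ltW // d_gt0.
Qed.
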